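(* Let $G=\langle g\rangle$ be cyclic of prime order $p$ and $B=\mathcal{O}G$. Then: (1) Every $I\in\operatorname{PI}(B)$ has homogeneous sign, i.e. either $I(\chi)\in\operatorname{Irr}(B)$ for all $\chi\in\operatorname{Irr}(B)$, or $-I(\chi)\in\operatorname{Irr}(B)$ for all $\chi\in\operatorname{Irr}(B)$. (2) Every $I\in\operatorname{PI}(B)$ with all-positive sign (i.e. $I(\chi)\in\operatorname{Irr}(B)$ for all $\chi\in\operatorname{Irr}(B)$) is a composition of isometries of the forms $I_\lambda$ ($\lambda\in\operatorname{Irr}(B)$) and $I_\sigma$ ($\sigma\in\operatorname{Aut}(G)$). (3) $\operatorname{PI}(B)\cong (G\rtimes\operatorname{Aut}(G))\times\langle -\mathrm{id}\rangle$, where $\langle-\mathrm{id}\rangle$ is cyclic of order 2 and $\operatorname{Aut}(G)$ acts naturally on $G$.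
   Context: Let $p$ be a prime, $\zeta$ a primitive $p$-th root of unity, $K=\mathbb{Q}_p(\zeta)$, $\mathcal{O}=\mathbb{Z}_p[\zeta]$. Let $G=\langle g\rangle$ be cyclic of order $p$; $B=\mathcal{O}G$ is its unique block and $\operatorname{Irr}(B)=\{\chi_0,\dots,\chi_{p-1}\}$ with $\chi_a(g^b)=\zeta^{ab}$. $R_K(B)$ is the free abelian group on $\operatorname{Irr}(B)$ with inner product $\langle\alpha,\beta\rangle=\frac1p\sum_{x\in G}\alpha(x)\beta(x^{-1})$. For a linear map $I:R_K(B)\to R_K(B)$ put $\mu_I(x,y)=\sum_{\chi\in\operatorname{Irr}(B)}I(\chi)(x)\chi(y)$, a generalized character of $G\times G$. A generalized character $\mu$ of $G\times G$ is perfect if (i) $\mu(x,y)/|C_G(x)|\in\mathcal{O}$ and $\mu(x,y)/|C_G(y)|\in\mathcal{O}$ for all $x,y$ (here $|C_G(x)|=p$); (ii) whenever $\mu(x,y)\ne0$, $x$ is $p$-regular (i.e. $x=1$) iff $y$ is $p$-regular. A perfect isometry of $R_K(B)$ is a bijective linear isometry $I$ of $R_K(B)$ with $\mu_I$ perfect; $\operatorname{PI}(B)$ is the group of these under composition. For $\lambda\in\operatorname{Irr}(B)$, $I_\lambda$ is the linear map with $I_\lambda(\chi)=\lambda\chi$ (pointwise product) for $\chi\in\operatorname{Irr}(B)$. For $\sigma\in\operatorname{Aut}(G)$, $I_\sigma$ is the linear map with $I_\sigma(\chi)=\chi^\sigma$, where $\chi^\sigma(h)=\chi(h^{\sigma^{-1}})$.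 *)

(* Defs.v *)
From HB Require Import structures.
From mathcomp Require Import all_boot all_order all_algebra all_fingroup all_solvable all_field all_character.
Set Implicit Arguments. Unset Strict Implicit. Unset Printing Implicit Defensive.
Import Order.TTheory GRing.Theory Num.Theory.
Local Open Scope group_scope.
Local Open Scope ring_scope.

(* x lies in O = Z_p[zeta] (read inside Q(zeta) ⊂ algC):
   x is integral over the localisation Z_(p). *)
Definition in_O (p : nat) (x : algC) : Prop :=
  exists2 m : nat, coprime m p & m%:R * x \in Aint.

Section PerfectIsometries.
Variables (gT : finGroupType) (G : {group gT}).

(* A Z-linear map I : R_K(B) -> 'CF(G) is given by the images of the basis
   Irr(B) = irr G; its linear extension: *)
Definition lin_ext (I : {ffun Iirr G -> 'CF(G)}) (psi : 'CF(G)) : 'CF(G) :=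
  \sum_(i : Iirr G) '[psi, 'chi_i] *: I i.

Definition comp_iso (I J : {ffun Iirr G -> 'CF(G)}) : {ffun Iirr G -> 'CF(G)} :=
  [ffun i => lin_ext I (J i)].

Definition id_iso : {ffun Iirr G -> 'CF(G)} := [ffun i => 'chi_i].

Definition mu_I (I : {ffun Iirr G -> 'CF(G)}) (x y : gT) : algC :=
  \sum_(i : Iirr G) I i x * 'chi_i y.

Definition perfect_mu (p : nat) (mu : gT -> gT -> algC) : Prop :=
  (forall x y, x \in G -> y \in G ->
      in_O p (mu x y / #|('C_G[x])%g|%:R) /\ in_O p (mu x y / #|('C_G[y])%g|%:R))
  /\ (forall x y, x \in G -> y \in G -> mu x y != 0 ->
      ((p^'.-elt x)%g <-> (p^'.-elt y)%g)).

Definition is_PI (p : nat) (I : {ffun Iirr G -> 'CF(G)}) : Prop :=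
  [/\ forall i, I i \in 'Z[irr G],
      {in 'Z[irr G] &, forall a b, '[lin_ext I a, lin_ext I b] = '[a, b]},
      {in 'Z[irr G] &, injective (lin_ext I)},
      (forall psi, psi \in 'Z[irr G] ->
         exists2 a, a \in 'Z[irr G] & lin_ext I a = psi)
    & perfect_mu p (mu_I I)].

Definition is_Ilambda (I : {ffun Iirr G -> 'CF(G)}) : Prop :=
  exists l : Iirr G, forall i, I i = 'chi_l * 'chi_i.

Definition is_Isigma (I : {ffun Iirr G -> 'CF(G)}) : Prop :=
  exists2 s : {perm gT}, s \in Aut G &
    forall i (h : gT), h \in G -> I i h = 'chi_i ((s^-1)%g h).

Definition comp_list (s : seq {ffun Iirr G -> 'CF(G)}) : {ffun Iirr G -> 'CF(G)} :=
  foldr comp_iso id_iso s.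

(* Multiplication in (G ⋊ Aut G) × <-id>:
   (a, s, e)(b, t, e') = (a * s(b), s o t, e xor e'). *)
Definition sdx_mul (x y : gT * {perm gT} * bool) : gT * {perm gT} * bool :=
  let: (a, s, e) := x in let: (b, t, e') := y in
  ((a * s b)%g, (t * s)%g (* = s o t, since (t * s) h = s (t h) *), addb e e').

End PerfectIsometries.

(* Main.v *)
(** Regularity of mu_I at x = 1 says that the class function with coefficients
    I(chi)(1) vanishes off 1, hence is a multiple of the regular character: all
    the signs agree. If all signs are positive, choose y with mu_I(g, y) <> 0.
    For every k, mu_I(g^k, y^k) is the value at g^k of a sum theta of p
    irreducible characters, and theta / p takes integral values; a Frobenius
    argument modulo p shows that the multiplicities in theta are all congruent
    modulo p. They are therefore either all 1, in which case theta is regular and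
    vanishes at g, or concentrated on one character. Since theta(g) <> 0, the
    latter holds, which makes I of the affine form chi |-> xi^k chi^m; such maps
    are multiplied and compared through their exponents modulo p. *)

Require Import Defs.
From HB Require Import structures.
From mathcomp Require Import all_boot all_order all_algebra all_fingroup all_solvable all_field all_character.
Import Order.TTheory GRing.Theory Num.Theory.
Local Open Scope ring_scope.

Set Implicit Arguments. Unset Strict Implicit. Unset Printing Implicit Defensive.

(** * Algebraic integers modulo [p] *)

Lemma eqAmod_exprD (p : nat) (x y : algC) : prime p ->
  x \in Aint -> y \in Aint -> ((x + y) ^+ p == x ^+ p + y ^+ p %[mod p])%A.
Proof.
move=> pr_p Ax Ay; case: p pr_p => [|p] // pr_p.
rewrite exprDn big_ord_recl big_ord_recr /= subn0 subnn !expr0 bin0 binn.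
rewrite mulr1 mul1r !mulr1n eqAmodDl -[X in (_ == X %[mod _])%A]add0r eqAmodDr.
rewrite eqAmod0 rpred_sum // => i _.
have /dvdnP[c ->]: (p.+1 %| 'C(p.+1, bump 0 i))%N by rewrite prime_dvd_bin ?ltnS ?ltn_ord.
rewrite -mulr_natr natrM mulrA -eqAmod0 eqAmodMl0 //.
by rewrite !rpredM ?rpredX ?rpred_nat.
Qed.

(** Turns the local integrality in a perfect character into a global one: if [1 + u m = v p], then
    [y = x / p] equals [v x - u (m y)], a combination of algebraic integers. *)
Lemma in_O_Aint (p : nat) (x : algC) : prime p ->
  in_O p (x / p%:R) -> x \in Aint -> x / p%:R \in Aint.
Proof.
move=> pr_p [m co_mp Amx] Ax; set y := x / _ in Amx *.
have nz_p: p%:R != 0 :> algC by rewrite pnatr_eq0 -lt0n prime_gt0.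
have [u _ /dvdnP[v eq_uv]] := Bezoutl m (prime_gt0 pr_p).
rewrite gcdnC (eqnP co_mp) in eq_uv.
suffices ->: y = v%:R * x - u%:R * (m%:R * y).
  by rewrite rpredB // rpredM ?rpred_nat.
rewrite mulrA -natrM -(divfK nz_p x) -/y [y * _]mulrC mulrA -natrM -eq_uv.
by rewrite -mulrBl -natrB ?leq_addl // addnK mul1r.
Qed.

(** * Linear extensions and signed permutations of the irreducible characters *)

Lemma lin_ext_irr (gT : finGroupType) (G : {group gT})
    (I : {ffun Iirr G -> 'CF(G)}) i : lin_ext I 'chi_i = I i.
Proof.
rewrite /lin_ext (bigD1 i) //= cfdot_irr eqxx scale1r big1 ?addr0 // => j ne_ji.
by rewrite cfdot_irr eq_sym (negPf ne_ji) scale0r.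
Qed.

Lemma lin_extZ (gT : finGroupType) (G : {group gT})
    (I : {ffun Iirr G -> 'CF(G)}) c phi :
  lin_ext I (c *: phi) = c *: lin_ext I phi.
Proof.
by rewrite /lin_ext scaler_sumr; apply: eq_bigr => i _; rewrite cfdotZl scalerA.
Qed.

Lemma lin_extB (gT : finGroupType) (G : {group gT})
    (I : {ffun Iirr G -> 'CF(G)}) phi psi :
  lin_ext I (phi - psi) = lin_ext I phi - lin_ext I psi.
Proof.
rewrite /lin_ext -sumrB; apply: eq_bigr => i _.
by rewrite cfdotBl scalerBl.
Qed.

Lemma is_PI_signed_perm (gT : finGroupType) (G : {group gT}) (p : nat)
    (e : bool) (f : Iirr G -> Iirr G) (I : {ffun Iirr G -> 'CF(G)}) :
  injective f -> (forall i, I i = (-1) ^+ e *: 'chi_(f i)) ->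
  perfect_mu G p (mu_I I) -> is_PI p I.
Proof.
move=> inj_f defI perfI.
have ZI i: I i \in 'Z[irr G]%g by rewrite defI scale_zchar ?irr_vchar ?rpred_sign.
have dotI i j: '[I i, I j] = (i == j)%:R.
  rewrite !defI cfdotZl cfdotZr cfdot_irr (inj_eq inj_f) conj_intr ?rpred_sign //.
  by rewrite mulrA -expr2 sqrr_sign mul1r.
have isoI phi psi: '[lin_ext I phi, lin_ext I psi] = '[phi, psi].
  rewrite [RHS]cfdot_sum_irr cfdot_suml; apply: eq_bigr => i _.
  rewrite cfdot_sumr (bigD1 i) //= cfdotZl cfdotZr dotI eqxx mulr1 big1 ?addr0 //.
  by move=> j ne_ji; rewrite cfdotZl cfdotZr dotI eq_sym (negPf ne_ji) !mulr0.
split=> // [phi psi _ _ eqI | psi Zpsi].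
  apply/eqP; rewrite -subr_eq0 -cfnorm_eq0 -isoI lin_extB eqI subrr.
  by rewrite cfdot0l.
(* The preimage is the image of [psi] under the adjoint of [I]. *)
exists (\sum_i ((-1) ^+ e * '[psi, 'chi_(f i)]) *: 'chi_i).
  rewrite rpred_sum // => i _; rewrite scale_zchar ?irr_vchar //.
  by rewrite rpredM ?rpred_sign ?Cint_cfdot_vchar_irr.
rewrite [RHS]cfun_sum_cfdot [RHS](reindex_inj inj_f) /=.
apply: eq_bigr => i _; rewrite cfdot_suml (bigD1 i) //=.
rewrite cfdotZl cfdot_irr eqxx.
rewrite mulr1 big1 ?addr0 => [|j ne_ji]; last first.
  by rewrite cfdotZl cfdot_irr (negPf ne_ji) mulr0.
by rewrite defI scalerA mulrAC -expr2 sqrr_sign mul1r.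
Qed.

(** * Groups of prime order: signs of perfect isometries *)

Section PrimeOrder.

Variables (gT : finGroupType) (G : {group gT}) (p : nat).
Hypotheses (pr_p : prime p) (oG : #|G| = p).

Let abG : abelian G.
Proof. by rewrite cyclic_abelian ?prime_cyclic ?oG. Qed.

Let lin_irr i : 'chi[G]_i \is a linear_char.
Proof. exact: char_abelianP. Qed.

Let nz_p : p%:R != 0 :> algC.
Proof. by rewrite pnatr_eq0 -lt0n prime_gt0. Qed.

Lemma card_centraliser1_prime x : x \in G -> #|('C_G[x])%g| = p.
Proof.
move=> Gx; rewrite -oG; congr #|pred_of_set _|; apply/setIidPl.
by apply/subsetP=> y Gy; apply/cent1P/(centsP abG).
Qed.

Lemma p'_elt_prime x : x \in G -> (p^'.-elt x)%g = (x == 1%g).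
Proof.
move=> Gx; have p_x: (p.-elt x)%g.
  by apply: mem_p_elt Gx; rewrite /pgroup oG pnat_id.
apply/idP/eqP => [p'x | ->]; last by rewrite /p_elt order1.
by apply/eqP; rewrite -order_eq1 (pnat_1 p_x).
Qed.

Lemma card_Iirr_prime : #|{: Iirr G}| = p.
Proof. by rewrite card_ord NirrE -oG; apply/eqP; rewrite -card_classes_abelian. Qed.

Lemma is_PI_sign I : is_PI p I -> exists e : bool, forall i : Iirr G,
  (-1) ^+ e *: I i \in irr G.
Proof.
case=> ZI isoI _ _ [_ perfI].
have dirrI i: exists b : bool, exists j : Iirr G, I i = (-1) ^+ b *: 'chi_j.
  apply: vchar_norm1P => //.
  by rewrite -lin_ext_irr isoI ?irr_vchar ?cfnorm_irr.
pose phi := \sum_i I i 1%g *: 'chi[G]_i.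
have phiE y: phi y = mu_I I 1%g y.
  by rewrite sum_cfunE; apply: eq_bigr => i _; rewrite cfunE.
(* Separation makes [phi] vanish off 1, so only the term at 1 survives, and it does not depend on
   [i]. *)
have phi_dot i: '[phi, 'chi_i] = p%:R^-1 * phi 1%g.
  rewrite cfdotE oG (bigD1 1%g) //= (lin_char1 (lin_irr i)) conjC1 mulr1 big1 ?addr0 //.
  move=> y /andP[Gy ny1]; apply/eqP; rewrite mulf_eq0; apply/orP; left.
  apply: contraR ny1; rewrite phiE => /(perfI _ _ (group1 G) Gy) [p'y _].
  by rewrite -p'_elt_prime //; apply: p'y; rewrite p'_elt_prime ?group1.
have I1 i: I i 1%g = I 0 1%g.
  have phi_irr j: '[phi, 'chi_j] = I j 1%g.
    rewrite cfdot_suml (bigD1 j) //= cfdotZl cfdot_irr eqxx mulr1 big1 ?addr0 //.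
    by move=> k ne_kj; rewrite cfdotZl cfdot_irr (negPf ne_kj) mulr0.
  by rewrite -!phi_irr !phi_dot.
have [e [j0 I0]] := dirrI 0; exists e => i.
have [b [j Ii]] := dirrI i.
have := I1 i; rewrite Ii I0 !cfunE !lin_char1 // !mulr1.
move/signr_inj->.
by rewrite scalerA -expr2 sqrr_sign scale1r mem_irr.
Qed.

(** * Multiplicities modulo [p] and positive perfect isometries *)

Lemma lin_char_expr_prime (xi : 'CF(G)) : xi \is a linear_char -> xi ^+ p = 1.
Proof.
move=> lin_xi; apply/cfun_inP=> x Gx; rewrite exp_cfunE // -lin_charX //.
by rewrite -oG expg_cardG // lin_char1 // cfun1E Gx.
Qed.

(** The difference [z] of the multiplicities is a combination, with integral coefficients
    [theta x / p], of differences [d x] of [p]-th roots of unity. Each [d x ^+ p] is 0 modulo [p],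
    hence so is [z ^+ p]; as [z] is a rational integer, [p] divides it. *)
Lemma cfdot_char_modp (theta : 'CF(G)) i j : theta \is a character ->
  {in G, forall x, theta x / p%:R \in Aint} ->
  ('[theta, 'chi_i] == '[theta, 'chi_j] %[mod p])%A.
Proof.
move=> Ntheta Atheta; set z := '[theta, 'chi_i] - '[theta, 'chi_j].
have Zz: z \in Num.int by rewrite rpredB ?Cint_cfdot_vchar_irr ?char_vchar.
pose d x := ('chi_i x)^* - ('chi_j x)^*.
have Ad x: d x \in Aint by rewrite rpredB // -cfConjCE Aint_char ?cfConjC_char ?irr_char.
have defz: z = \sum_(x in G) theta x / p%:R * d x.
  rewrite /z !cfdotE oG -mulrBr -sumrB mulr_sumr; apply: eq_bigr => x _.
  by rewrite -mulrBr mulrCA mulrA.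
have lin_exp k x : x \in G -> ('chi[G]_k x)^* ^+ p = 1.
  move=> Gx; rewrite -rmorphXn -lin_charX // -oG expg_cardG // lin_char1 //.
  exact: rmorph1.
have dp x: x \in G -> (d x ^+ p == 0 %[mod p])%A.
  move=> Gx; have Aj: ('chi_j x)^* \in Aint by rewrite -cfConjCE Aint_char ?cfConjC_char ?irr_char.
  have := eqAmod_exprD pr_p (Ad x) Aj.
  by rewrite /d subrK !lin_exp // -[X in (X == _ %[mod _])%A]add0r eqAmodDr eqAmod_sym.
have [_ zp]: z \in Aint /\ (z ^+ p == 0 %[mod p])%A.
  rewrite defz; elim/big_ind: _ => [|u v [Au up] [Av vp]|x Gx].
  - by rewrite rpred0 expr0n gtn_eqF ?prime_gt0.
  - rewrite rpredD //; split=> //; apply: eqAmod_trans (eqAmod_exprD pr_p Au Av) _.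
    by rewrite -[X in (_ == X %[mod _])%A]addr0 eqAmodD.
  rewrite rpredM ?Atheta //; split=> //.
  by rewrite exprMn -(mulr0 ((theta x / p%:R) ^+ p)) eqAmodMl ?rpredX ?Atheta ?dp.
move: zp; rewrite /eqAmod subr0 -/z -!eqAmod0; have /intrP[m ->] := Zz.
rewrite -rmorphXn !eqAmod0_rat ?rpred_int ?rpred_nat // !dvdC_int ?intr_int //=.
by rewrite !intrKfloor abszX Euclid_dvdX // => /andP[].
Qed.

Lemma irr_sum_Aint_const (f : Iirr G -> Iirr G) (g : gT) :
    g \in G -> g != 1%g -> \sum_i 'chi_(f i) g != 0 ->
    {in G, forall x, (\sum_i 'chi_(f i) x) / p%:R \in Aint} ->
  forall i, f i = f 0.
Proof.
move=> Gg ntg nz_g Aint_f i.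
pose theta := \sum_i 'chi_(f i).
pose n j := #|[pred k | f k == j]|.
have theta_dot j: '[theta, 'chi_j] = (n j)%:R.
  rewrite cfdot_suml /n -sum1_card natr_sum [RHS]big_mkcond /=.
  by apply: eq_bigr => k _; rewrite cfdot_irr inE; case: eqP.
have n_mod j k: n j = n k %[mod p].
  have Ntheta: theta \is a character.
    by rewrite rpred_sum // => l _; apply: irr_char.
  have Atheta: {in G, forall x, theta x / p%:R \in Aint}.
    by move=> x Gx; rewrite sum_cfunE; apply: Aint_f.
  apply/eqP; rewrite -eqAmod_nat.
  by have := cfdot_char_modp j k Ntheta Atheta; rewrite !theta_dot.
(* If every irreducible character occurred, [f] would be bijective and the sum would be the regular
   character, which vanishes at [g]. *)
have /existsP[j /eqP nj0]: [exists j, n j == 0%N].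
  apply: contraR nz_g; rewrite negb_exists => /forallP n_neq0.
  have /fin_all_exists[h hK] j: exists k, f k = j.
    by have := n_neq0 j; rewrite -lt0n => /card_gt0P[k /eqP <-]; exists k.
  have inj_f: injective f by apply: can_inj (canF_sym hK).
  suffices ->: \sum_i 'chi_(f i) g = cfReg G g by rewrite cfRegE (negPf ntg).
  rewrite cfReg_sum sum_cfunE [RHS](reindex_inj inj_f).
  by apply: eq_bigr => k _; rewrite cfunE lin_char1 // mul1r.
have nf0_gt0: (0 < n (f 0%R))%N by apply/card_gt0P; exists (0 : Iirr G); rewrite inE.
(* The fibre over [f 0] thus has at least [p] elements; missing a single [i] would leave it
   fewer. *)
have: (p %| n (f 0%R))%N by rewrite /dvdn (n_mod _ j) nj0 mod0n.
move/(dvdn_leq nf0_gt0); apply: contraTeq => ne_fi; rewrite -ltnNge.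
rewrite -card_Iirr_prime (cardD1 i) inE add1n ltnS.
apply: subset_leq_card; apply/subsetP=> k; rewrite !inE andbT.
by apply: contraTneq => ->.
Qed.

Lemma positive_perfect_pow (g : gT) (J : {ffun Iirr G -> 'CF(G)}) :
    G :=: <[g]>%g -> (forall i, J i \in irr G) -> perfect_mu G p (mu_I J) ->
  exists2 m, coprime p m & forall i, J i = J 0 * 'chi_i ^+ m.
Proof.
move=> defG irrJ [OJ regJ]; have Gg: g \in G by rewrite defG cycle_id.
have ntg: g != 1%g.
  by rewrite -order_gt1 orderE -defG oG prime_gt1.
have linJ i: J i \is a linear_char by have /irrP[j ->] := irrJ i.
(* The class function [mu_I J g] has coefficient [J 0 g], a nonzero value of a linear character, at
   the trivial character. *)
have [y Gy nz_gy]: exists2 y, y \in G & mu_I J g y != 0.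
  pose phi := \sum_i J i g *: 'chi[G]_i.
  have: '[phi, 'chi_0] != 0.
    rewrite cfdot_suml (bigD1 0) //= cfdotZl cfdot_irr mulr1 big1 ?addr0 //.
      by rewrite lin_char_neq0.
    by move=> k ne_k0; rewrite cfdotZl cfdot_irr (negPf ne_k0) mulr0.
  move=> nz_phi; apply/exists_inP; apply: contraR nz_phi.
  rewrite negb_exists_in => /forall_inP no_y; suffices ->: phi = 0 by rewrite cfdot0l.
  apply/cfun_inP=> y Gy; rewrite cfunE sum_cfunE.
  transitivity (mu_I J g y); first by apply: eq_bigr => i _; rewrite cfunE.
  by apply/eqP; rewrite -[_ == _]negbK no_y.
have nty: y != 1%g.
  have [_] := regJ _ _ Gg Gy nz_gy; rewrite !p'_elt_prime //.
  by move=> y1_g1; apply: contra y1_g1 ntg.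
have /cycleP[n defy]: y \in <[g]>%g by rewrite -defG.
have copn: coprime p n.
  by rewrite prime_coprime // -oG defG -orderE order_dvdn -defy.
have /fin_all_exists[f Jf] i: exists j, J i * 'chi_i ^+ n = 'chi_j.
  have /irrP[j ->]: J i * 'chi_i ^+ n \in irr G.
    by rewrite lin_char_irr // rpredM ?rpredX.
  by exists j.
have mu_pow k: \sum_i 'chi_(f i) (g ^+ k)%g = mu_I J (g ^+ k)%g (y ^+ k)%g.
  apply: eq_bigr => i _; rewrite -Jf cfunE exp_cfunE ?groupX //.
  by rewrite -lin_charX ?groupX // -expgM mulnC expgM -defy.
(* This exponent is [-n] modulo [p]: constancy of [J i * 'chi_i ^+ n] gives
   [J i = J 0 * 'chi_i ^- n]. *)
exists (n * p.-1)%N.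
  rewrite coprimeMr copn prime_coprime // -subn1 gtnNdvd //.
    by rewrite subn_gt0 prime_gt1.
  by rewrite ltn_subrL (prime_gt0 pr_p).
move=> i.
have: f i = f 0.
  apply: (irr_sum_Aint_const Gg ntg).
    by rewrite -[g]expg1 mu_pow !expg1.
  move=> x; rewrite {1}defG => /cycleP[k ->]; rewrite mu_pow.
  have [//|//|] := OJ (g ^+ k)%g (y ^+ k)%g _ _; rewrite ?groupX //.
  rewrite card_centraliser1_prime ?groupX // => Omu _; apply: in_O_Aint => //.
  rewrite rpred_sum // => j _; rewrite rpredM ?Aint_irr //.
  by have /irrP[l ->] := irrJ j; apply: Aint_irr.
move/(congr1 (fun j => 'chi_j)); rewrite -!Jf irr0 expr1n mulr1 => <-.
rewrite -mulrA -exprD -mulnS prednK ?prime_gt0 // mulnC exprM.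
by rewrite lin_char_expr_prime // expr1n mulr1.
Qed.

(** * Exponents modulo [p] and affine isometries *)

Lemma lin_char_expr_mod (xi : 'CF(G)) m n :
  xi \is a linear_char -> m = n %[mod p] -> xi ^+ m = xi ^+ n.
Proof.
by move=> /lin_char_expr_prime xip eq_mn; rewrite -(expr_mod m xip) eq_mn expr_mod.
Qed.

Lemma expgn_Aut m : coprime p m ->
  exists2 s : {perm gT}, s \in Aut G & {in G, forall x, s x = x ^+ m}%g.
Proof.
move=> co_pm; have co_Gm: coprime #|G| m by rewrite oG.
have inj_m: {in G &, injective (fun x => x ^+ m)%g} by apply: can_in_inj (expgK co_Gm).
have sGm: ((fun x => x ^+ m)%g @: G \subset G).
  by apply/subsetP=> _ /imsetP[x Gx ->]; rewrite groupX.
exists (perm_in inj_m sGm) => [|x Gx]; last exact: perm_inE.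
rewrite inE perm_in_on; apply/morphicP=> x y Gx Gy.
by rewrite !perm_inE ?groupM // expgMn //; apply: (centsP abG).
Qed.

(** When [xi] generates the linear characters, this is, up to sign, the affine map [a |-> k + m a]
    on exponents of [xi]. Exponents stay natural numbers, so that composition needs no reduction
    modulo [p]. *)
Definition affine_iso (xi : 'CF(G)) (k m : nat) (e : bool) :
    {ffun Iirr G -> 'CF(G)} :=
  [ffun i => (-1) ^+ e *: (xi ^+ k * 'chi_i ^+ m)].

Section AffineIso.

Variables (xi : 'CF(G)) (k m : nat) (e : bool).
Hypotheses (lin_xi : xi \is a linear_char) (co_pm : coprime p m).

Lemma affine_iso_signed_perm : exists2 f : Iirr G -> Iirr G,
  injective f & forall i, affine_iso xi k m e i = (-1) ^+ e *: 'chi_(f i).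
Proof.
have irr_f i: xi ^+ k * 'chi_i ^+ m \in irr G.
  by rewrite lin_char_irr // rpredM ?rpredX.
exists (fun i => cfIirr (xi ^+ k * 'chi_i ^+ m)) => [i j /(congr1 (tnth (irr G)))|i].
  rewrite !cfIirrE // => /(mulrI (rpredX k (lin_char_unitr lin_xi))) eq_m.
  (* Here [1 + a m = c p], so the [a]-th power of ['chi_l ^+ m] is the inverse of ['chi_l]. *)
  have [a _ /dvdnP[c]] := Bezoutl m (prime_gt0 pr_p).
  rewrite (eqnP co_pm) add1n => ca.
  have inv_exp l: 'chi_l * 'chi[G]_l ^+ m ^+ a = 1.
    by rewrite -exprM -exprS mulnC ca mulnC exprM lin_char_expr_prime ?expr1n.
  apply/irr_inj/(mulIr (rpredX a (rpredX m (lin_char_unitr (lin_irr i))))).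
  by rewrite inv_exp eq_m inv_exp.
by rewrite ffunE cfIirrE.
Qed.

(** All irreducible characters are linear, so the sum collapses to the regular character at
    [x ^+ m * y]. Both perfectness conditions follow, since that value is [p] or 0 and is nonzero
    only for [y = x ^- m]. *)
Lemma mu_affine_iso x y : x \in G -> y \in G ->
  mu_I (affine_iso xi k m e) x y = (-1) ^+ e * xi x ^+ k * cfReg G (x ^+ m * y)%g.
Proof.
move=> Gx Gy; rewrite cfReg_sum sum_cfunE mulr_sumr; apply: eq_bigr => i _.
rewrite ffunE !cfunE !exp_cfunE // lin_char1 // mul1r -!mulrA; do 2!congr (_ * _).
by rewrite lin_charM ?groupX // lin_charX.
Qed.

Lemma affine_iso_perfect : perfect_mu G p (mu_I (affine_iso xi k m e)).
Proof.
split=> x y Gx Gy.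
  suffices Omu: in_O p (mu_I (affine_iso xi k m e) x y / p%:R).
    by rewrite !card_centraliser1_prime.
  exists 1%N; first exact: coprime1n.
  rewrite mul1r mu_affine_iso // -!mulrA rpredM ?rpred_sign //.
  rewrite rpredM ?rpredX ?Aint_char ?lin_charW //.
  rewrite cfRegE oG mulrb; case: ifP => _; last by rewrite mul0r rpred0.
  by rewrite divff // rpred1.
rewrite mu_affine_iso // cfRegE !p'_elt_prime // mulrb.
have [xmy _ | _] := eqVneq (x ^+ m * y)%g 1%g; last by rewrite mulr0 eqxx.
have ->: (y == 1%g) = (x ^+ m == 1)%g.
  by rewrite -(inj_eq (mulgI (x ^+ m)%g)) xmy mulg1 eq_sym.
split=> [/eqP-> | xm1]; first by rewrite expg1n.
rewrite -order_eq1 -dvdn1 -(eqnP co_pm) dvdn_gcd [X in _ && X]order_dvdn.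
by rewrite xm1 andbT -oG order_dvdG.
Qed.

Lemma affine_iso_PI : is_PI p (affine_iso xi k m e).
Proof.
have [f inj_f defI] := affine_iso_signed_perm.
exact: is_PI_signed_perm inj_f defI affine_iso_perfect.
Qed.

End AffineIso.

Lemma lin_ext_affine_iso xi k m e (psi : 'CF(G)) : psi \is a linear_char ->
  lin_ext (affine_iso xi k m e) psi = (-1) ^+ e *: (xi ^+ k * psi ^+ m).
Proof.
by move/lin_char_irr/irrP=> [i ->]; rewrite lin_ext_irr ffunE.
Qed.

Lemma comp_affine_iso xi k m e k' m' e' : xi \is a linear_char ->
  comp_iso (affine_iso xi k m e) (affine_iso xi k' m' e') =
    affine_iso xi (k + k' * m) (m' * m) (e (+) e').
Proof.
move=> lin_xi; apply/ffunP=> i; rewrite !ffunE lin_extZ lin_ext_affine_iso.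
  by rewrite scalerA mulrC -signr_addb exprMn -!exprM mulrA -exprD.
by rewrite rpredM ?rpredX.
Qed.

Lemma eq_affine_iso xi k m k' m' e : xi \is a linear_char ->
  k = k' %[mod p] -> m = m' %[mod p] ->
  affine_iso xi k m e = affine_iso xi k' m' e.
Proof.
move=> lin_xi eq_k eq_m; apply/ffunP=> i; rewrite !ffunE.
by rewrite (lin_char_expr_mod lin_xi eq_k) (lin_char_expr_mod _ eq_m).
Qed.

(** * Coordinates given by a generator of [G] *)

Section Generator.

Variable g : gT.
Hypothesis defG : G :=: <[g]>%g.

Let Gg : g \in G. Proof. by rewrite defG cycle_id. Qed.

Let og : #[g]%g = p. Proof. by rewrite orderE -defG. Qed.

Lemma lin_char_gen_inj (chi psi : 'CF(G)) :
    chi \is a linear_char -> psi \is a linear_char ->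
  chi g = psi g -> chi = psi.
Proof.
move=> lin_chi lin_psi eq_g; apply/cfun_inP=> x; rewrite {1}defG.
by case/cycleP=> n ->; rewrite !lin_charX // eq_g.
Qed.

(** Any nontrivial irreducible character serves: its value at [g] is a [p]-th root of unity, and it
    is not 1 because that value determines the character. *)
Lemma exists_lin_char_prim_root : exists2 xi : 'CF(G),
  xi \is a linear_char & p.-primitive_root (xi g).
Proof.
have /card_gt0P[i]: (0 < #|[predD1 Iirr G & (0%R : Iirr G)]|)%N.
  by have := prime_gt1 pr_p; rewrite -card_Iirr_prime (cardD1 (0 : Iirr G)).
rewrite !inE andbT => nz_i; exists 'chi_i => //.
have xip: 'chi_i g ^+ p = 1.
  by rewrite -lin_charX // -og expg_order lin_char1.
have [m prim_m m_p] := prim_order_exists (prime_gt0 pr_p) xip.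
have /primeP[_ /(_ m m_p)/pred2P[m1|<-//]] := pr_p.
case/eqP: nz_i; apply/irr_inj; rewrite irr0.
apply: lin_char_gen_inj; rewrite ?cfun1_lin_char // cfun1E Gg.
by have := prim_expr_order prim_m; rewrite m1 expr1.
Qed.

(* The discrete logarithm to base [g]; it is [0] outside [<[g]>]. *)
Definition dlog x : nat := odflt 0%N (omap val [pick n : 'I_p | g ^+ n == x]%g).

Lemma dlogK x : x \in G -> (g ^+ dlog x)%g = x.
Proof.
rewrite {1}defG /dlog; case: pickP => [n /eqP // | no_n /cyclePmin[n lt_n defx]].
by rewrite og in lt_n; have /eqP[] := no_n (Ordinal lt_n).
Qed.

Lemma dlog_expg n : dlog (g ^+ n)%g = n %[mod p].
Proof. by apply/eqP; rewrite -og -eq_expg_mod_order dlogK ?groupX. Qed.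

Lemma Aut_dlog (s : {perm gT}) : s \in Aut G ->
  coprime p (dlog (s g)) /\ {in G, forall x, s x = x ^+ dlog (s g)}%g.
Proof.
move=> AutGs; have Gsg: s g \in G by rewrite Aut_closed.
have sX n: s (g ^+ n)%g = (s g ^+ n)%g.
  by rewrite -!(autmE AutGs) morphX.
split=> [|x]; last first.
  by rewrite {1}defG => /cycleP[n ->]; rewrite sX -{1}(dlogK Gsg) -!expgM mulnC.
rewrite prime_coprime // -og order_dvdn dlogK //.
have ntg: g != 1%g by rewrite -order_gt1 og prime_gt1.
by apply: contra ntg => /eqP sg1; apply/eqP/(@perm_inj _ s); rewrite sg1 -(expg0 g) sX.
Qed.

Variable xi : 'CF(G).
Hypotheses (lin_xi : xi \is a linear_char) (prim_xi : p.-primitive_root (xi g)).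

Lemma lin_char_powP (chi : 'CF(G)) : chi \is a linear_char ->
  exists k, chi = xi ^+ k.
Proof.
move=> lin_chi; have chip: chi g ^+ p = 1.
  by rewrite -lin_charX // -og expg_order lin_char1.
have [k chi_g] := prim_rootP prim_xi chip; exists k.
by apply: lin_char_gen_inj; rewrite ?rpredX // exp_cfunE.
Qed.

(** The sign is read off at the element 1, then [k] from the image of the trivial character at [g],
    then [m] from the image of [xi] at [g]. *)
Lemma affine_iso_inj k m e k' m' e' :
    affine_iso xi k m e = affine_iso xi k' m' e' ->
  [/\ k = k' %[mod p], m = m' %[mod p] & e = e'].
Proof.
move=> eqI; have eqIx (i : Iirr G) x : x \in G ->
    (-1) ^+ e * (xi x ^+ k * 'chi_i x ^+ m) =
    (-1) ^+ e' * (xi x ^+ k' * 'chi_i x ^+ m').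
  move=> Gx; have := congr1 (fun I : {ffun Iirr G -> 'CF(G)} => I i x) eqI.
  by rewrite !ffunE !cfunE !exp_cfunE.
have ee': e = e'.
  have := eqIx 0 1%g (group1 G).
  by rewrite !lin_char1 // !expr1n !mulr1 => /signr_inj.
have eqIx' (i : Iirr G) : xi g ^+ k * 'chi_i g ^+ m = xi g ^+ k' * 'chi_i g ^+ m'.
  by apply: (can_inj (signrMK e)); rewrite eqIx // ee'.
have kk': xi g ^+ k = xi g ^+ k'.
  by have := eqIx' 0; rewrite irr0 cfun1E Gg !expr1n !mulr1.
have /irrP[i xi_i] := lin_char_irr lin_xi.
have mm': xi g ^+ m = xi g ^+ m'.
  have := eqIx' i; rewrite -xi_i kk' => /mulfI; apply.
  by rewrite expf_neq0 ?lin_char_neq0.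
by split=> //; apply/eqP; rewrite -(eq_prim_root_expr prim_xi) ?kk' ?mm'.
Qed.

Lemma positive_PI_affine (J : {ffun Iirr G -> 'CF(G)}) :
    (forall i, J i \in irr G) -> perfect_mu G p (mu_I J) ->
  exists k, exists2 m, coprime p m & J = affine_iso xi k m false.
Proof.
move=> irrJ perfJ; have [m co_pm JE] := positive_perfect_pow defG irrJ perfJ.
have /lin_char_powP[k J0]: J 0 \is a linear_char by have /irrP[j ->] := irrJ 0.
by exists k, m => //; apply/ffunP=> i; rewrite ffunE scale1r JE J0.
Qed.

Lemma PI_affine I : is_PI p I ->
  exists k, exists2 m, coprime p m & exists e, I = affine_iso xi k m e.
Proof.
move=> PI_I; have [e irrI] := is_PI_sign PI_I.
case: PI_I => _ _ _ _ [OI regI].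
pose J := [ffun i => (-1) ^+ e *: I i].
have muJ x y: mu_I J x y = (-1) ^+ e * mu_I I x y.
  rewrite mulr_sumr; apply: eq_bigr => i _.
  by rewrite !ffunE cfunE mulrA.
have [||k [m co_pm defJ]] := @positive_PI_affine J.
- by move=> i; rewrite ffunE.
- split=> x y Gx Gy; last by rewrite muJ mulf_eq0 signr_eq0; apply: regI.
  have sgn_O z: in_O p z -> in_O p ((-1) ^+ e * z).
    by case=> n co_np An; exists n; rewrite // mulrCA rpredM ?rpred_sign.
  by rewrite muJ -!mulrA; split; apply: sgn_O; case: (OI x y Gx Gy).
exists k, m => //; exists e; apply/ffunP=> i.
have /ffunP/(_ i) := defJ; rewrite !ffunE scale1r => <-.
by rewrite scalerA -expr2 sqrr_sign scale1r.
Qed.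

End Generator.

End PrimeOrder.

Theorem mainTheorem4 (gT : finGroupType) (G : {group gT}) (p : nat) :
  prime p -> #|G| = p -> cyclic G ->
  (* (1) homogeneous sign *)
  (forall I : {ffun Iirr G -> 'CF(G)}, is_PI p I ->
     (forall i, I i \in irr G) \/ (forall i, - I i \in irr G))
  /\
  (* (2) all-positive perfect isometries are compositions of I_lambda, I_sigma *)
  (forall I : {ffun Iirr G -> 'CF(G)}, is_PI p I -> (forall i, I i \in irr G) ->
     exists2 s : seq {ffun Iirr G -> 'CF(G)},
       (forall J, J \in s -> is_Ilambda J \/ is_Isigma J) & I = comp_list s)
  /\
  (* (3) PI(B) ≅ (G ⋊ Aut G) × <-id> *)
  (exists Phi : gT * {perm gT} * bool -> {ffun Iirr G -> 'CF(G)},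
     [/\ forall x, x.1.1 \in G -> x.1.2 \in Aut G -> is_PI p (Phi x),
         forall x y, x.1.1 \in G -> x.1.2 \in Aut G ->
                     y.1.1 \in G -> y.1.2 \in Aut G -> Phi x = Phi y -> x = y,
         forall I, is_PI p I ->
           exists2 x, (x.1.1 \in G) && (x.1.2 \in Aut G) & Phi x = I
       & forall x y, x.1.1 \in G -> x.1.2 \in Aut G ->
                     y.1.1 \in G -> y.1.2 \in Aut G ->
           comp_iso (Phi x) (Phi y) = Phi (sdx_mul x y)]).
Proof.
move=> pr_p oG /cyclicP[g defG].
have abG: abelian G by rewrite cyclic_abelian ?prime_cyclic ?oG.
have lin_irr: forall i, 'chi[G]_i \is a linear_char by apply/char_abelianP.
have Gg: g \in G by rewrite defG cycle_id.
have og: #[g]%g = p by rewrite orderE -defG.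
have [xi lin_xi prim_xi] := exists_lin_char_prim_root pr_p oG defG.
split=> [I PI_I|].
  have [[] irrI] := is_PI_sign pr_p oG PI_I; [right | left] => i.
    by rewrite -scaleN1r; apply: irrI.
  by have := irrI i; rewrite scale1r.
split=> [I [_ _ _ _ perfI] irrI|].
  have [k [m co_pm ->]] := positive_PI_affine pr_p oG defG lin_xi prim_xi irrI perfI.
  have [s AutGs sE] := expgn_Aut pr_p oG co_pm.
  pose Il : {ffun Iirr G -> 'CF(G)} := [ffun i => xi ^+ k * 'chi_i].
  pose Is : {ffun Iirr G -> 'CF(G)} := [ffun i => 'chi_i ^+ m].
  exists [:: Il; Is] => [J|].
    rewrite !inE => /pred2P[]->; [left | right].
      have /irrP[l xik]: xi ^+ k \in irr G by rewrite lin_char_irr ?rpredX.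
      by exists l => i; rewrite ffunE xik.
    (* [I_sigma] composes characters with the inverse of [sigma], so [s^-1] yields [h |-> h ^+ m]
       inside the character. *)
    exists (s^-1)%g => [|i h Gh]; first by rewrite groupV.
    by rewrite invgK sE // ffunE exp_cfunE // lin_charX.
  apply/ffunP=> i; rewrite /= !ffunE lin_ext_irr !ffunE.
  have /irrP[j chim]: 'chi_i ^+ m \in irr G by rewrite lin_char_irr ?rpredX.
  by rewrite scale1r chim lin_ext_irr ffunE.
(* [Phi (a, s, e)] is [(-1)^e I_lambda I_(s^-1)] with [lambda = xi ^+ log a]: the
   inverse is needed for [lambda] to be equivariant, and it is harmless because
   [Aut G] is abelian. *)
pose log := dlog p g.
exists (fun x : gT * {perm gT} * bool =>
  affine_iso xi (log x.1.1) (log (x.1.2 g)) x.2).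
split=> [x _ Aut_x | [[a s] e] [[b t] e'] /= Ga Aut_s Gb Aut_t | I PI_I |
         [[a s] e] [[b t] e'] /= Ga Aut_s Gb Aut_t].
- apply: affine_iso_PI => //.
  by case: (Aut_dlog pr_p oG defG Aut_x).
- case/(affine_iso_inj pr_p oG defG lin_xi prim_xi) => eq_ab eq_st ->.
  have log_inj x y: x \in G -> y \in G -> log x = log y %[mod p] -> x = y.
    move=> Gx Gy /eqP; rewrite -og -eq_expg_mod_order.
    by rewrite !(dlogK oG defG) // => /eqP.
  have -> := log_inj a b Ga Gb eq_ab.
  have eq_stg: s g = t g by apply: log_inj; rewrite // Aut_closed.
  suffices ->: s = t by [].
  apply: (eq_Aut Aut_s Aut_t) => x Gx.
  have [[_ ->] // [_ ->] //] := (Aut_dlog pr_p oG defG Aut_s, Aut_dlog pr_p oG defG Aut_t).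
  by rewrite eq_stg.
- have [k [m co_pm [e ->]]] := PI_affine pr_p oG defG lin_xi prim_xi PI_I.
  have [s AutGs sE] := expgn_Aut pr_p oG co_pm.
  (* The logarithms of [g ^+ k] and of [s g = g ^+ m] recover [k] and [m] only modulo [p], which is
     enough. *)
  exists ((g ^+ k)%g, s, e) => /=; first by rewrite groupX.
  by apply: (eq_affine_iso pr_p oG) => //; rewrite ?sE // /log (dlog_expg oG defG).
rewrite (comp_affine_iso pr_p oG) //.
have [_ sE] := Aut_dlog pr_p oG defG Aut_s.
(* Since [s] raises to the power [log (s g)], the translation exponent is the logarithm of [a * s b]
   and the multiplier that of [s (t g)], both modulo [p]. *)
apply: (eq_affine_iso pr_p oG) => //.
  rewrite -(dlog_expg oG defG (_ + _)) expgD expgM !(dlogK oG defG) //.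
  by rewrite (sE b).
rewrite permM -(dlog_expg oG defG (_ * _)) expgM (dlogK oG defG) ?Aut_closed //.
by rewrite -sE ?Aut_closed.
Qed.
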